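(* Let $k$ be an algebraically closed field of characteristic $p\ge 5$. Then there exists a polynomial $1$-form $\omega$ on $\mathbb A^2_k$, with $\omega(0)\neq 0$, that leaves invariant a reduced affine curve $C=\mathcal Z(f)\subset\mathbb A^2_k$ of degree $\lceil\frac p2\rceil+1$ which is singular at the origin. Furthermore, $C$ is defined by a polynomial of the form $$f(x,y)=\left(y+P(x)+x^{\lfloor\frac p2\rfloor}+x^{\lceil\frac p2\rceil}\right)^2-x^p(2+x),$$ where $P\in k[x]$ satisfies $P(0)=0$ and $\deg P=\lfloor\frac p2\rfloor-1$.
   Context: A polynomial $1$-form $\omega$ on $\mathbb A^2_k$ leaves a reduced curve $C=\mathcal Z(f)$ invariant if $\omega\wedge\frac{df}{f}$ is a regular $2$-form, i.e. $f$ divides the coefficient of $\omega\wedge df$ in $k[x,y]$. Here $\omega(0)$ is the value of $\omega$ at the origin $(0,0)$, and the degree of $C$ is $\deg f$. *)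

(* Defs.v *)
From mathcomp Require Import all_boot all_order all_algebra.
From mathcomp Require Import mpoly.

Set Implicit Arguments.
Unset Strict Implicit.
Unset Printing Implicit Defensive.

Import GRing.Theory.
Local Open Scope ring_scope.

Section AffinePlane.
Variable k : fieldType.

Definition varx : {mpoly k[2]} := 'X_(0 : 'I_2).
Definition vary : {mpoly k[2]} := 'X_(1 : 'I_2).

Definition dpx (f : {mpoly k[2]}) : {mpoly k[2]} := mderiv (0 : 'I_2) f.
Definition dpy (f : {mpoly k[2]}) : {mpoly k[2]} := mderiv (1 : 'I_2) f.

Definition ev0 (f : {mpoly k[2]}) : k := f.@[fun _ : 'I_2 => 0].

Definition inx (P : {poly k}) : {mpoly k[2]} :=
  (map_poly (@mpolyC 2 k) P).[varx].

Record form1 := Form1 { coef_dx : {mpoly k[2]}; coef_dy : {mpoly k[2]} }.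

Definition form1_at0 (w : form1) : k * k := (ev0 (coef_dx w), ev0 (coef_dy w)).

Definition differential (f : {mpoly k[2]}) : form1 := Form1 (dpx f) (dpy f).

(* 2-forms are represented by their coefficient with respect to dx /\ dy *)
Definition wedge (w1 w2 : form1) : {mpoly k[2]} :=
  coef_dx w1 * coef_dy w2 - coef_dy w1 * coef_dx w2.

Definition mpdvd (f g : {mpoly k[2]}) : Prop := exists q, g = q * f.

Definition leaves_invariant (w : form1) (f : {mpoly k[2]}) : Prop :=
  mpdvd f (wedge w (differential f)).

(* k[x, y] / (f) has no nonzero nilpotent element *)
Definition reduced (f : {mpoly k[2]}) : Prop :=
  forall (g : {mpoly k[2]}) (n : nat), mpdvd f (g ^+ n) -> mpdvd f g.

Definition singular_at0 (f : {mpoly k[2]}) : Prop :=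
  [/\ ev0 f = 0, ev0 (dpx f) = 0 & ev0 (dpy f) = 0].

(* [msize] is one more than the total degree, and 0 for the zero polynomial *)
Definition has_degree (f : {mpoly k[2]}) (d : nat) : Prop := msize f = d.+1.

End AffinePlane.

Arguments varx {k}.
Arguments vary {k}.

(* Main.v *)
(** Write p = 2m+1, u = y + Q(x) and S = x^p (2 + x), so that f = u^2 - S with
    S' = x^p.  Then df = 2u du - x^p dx, and the form u dx - 2(2 + x) du wedges
    with df to 2f; its dy-coefficient at the origin is -4.  The curve is
    reduced because S vanishes to odd order at 0, hence is not a square in
    k(x).  The degree drops to m+2 when Q agrees with the expansion of sqrt(S)
    at infinity down to x^2, and these coefficients can be computed one by one
    since 2 is invertible. *)
From HB Require Import structures.
Require Import Defs.
From mathcomp Require Import all_boot all_order all_algebra.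
From mathcomp Require Import mpoly ring zify.

Import GRing.Theory.
Local Open Scope ring_scope.

(** * Reducedness of R[u]/(u^2 - S) *)

(** Since x - y divides x^n - y^n, whether [F] divides an n-th power depends only on the base modulo
    [F]. *)
Lemma dvd_exp_congr (R : comNzRingType) (F x y : R) (n : nat) :
  (exists q, x - y = q * F) -> (exists q, x ^+ n = q * F) ->
  exists q, y ^+ n = q * F.
Proof.
move=> [q1 xy] [q2 xn]; set c := \sum_(i < n) x ^+ (n.-1 - i) * y ^+ i.
exists (q2 - q1 * c); have := subrXX x y n.
rewrite xy xn -/c => e; rewrite mulrBl -mulrA [c * F]mulrC mulrA -e; ring.
Qed.

(* The norm of a + b u, namely a^2 - b^2 S, is a constant in u; if u^2 - S
   divides a power of a + b u, it divides a power of the norm. *)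
Lemma dvd_exp_sqr_sub (R : idomainType) (S : R) (g : {poly R}) (n : nat) :
  (forall a b, a ^+ 2 = b ^+ 2 * S -> b = 0) ->
  (exists q, g ^+ n = q * ('X ^+ 2 - S%:P)) ->
  exists q, g = q * ('X ^+ 2 - S%:P).
Proof.
move=> nsq; set G := _ - _ => Gg.
have szG : size G = 3 by rewrite size_XnsubC.
have monG : G \is monic by apply: monicXnsubC.
have eg := Pdiv.RingMonic.rdivp_eq monG g.
set q0 := Pdiv.CommonRing.rdivp g G in eg.
set r := Pdiv.CommonRing.rmodp g G in eg.
have szr : (size r <= 2)%N.
  have := Pdiv.Ring.ltn_rmodp g G.
  by rewrite -/r szG ltnS => ->; rewrite monic_neq0.
have er : r = r`_1 *: 'X + (r`_0)%:P.
  apply/polyP => -[|[|i]]; rewrite coefD coefZ coefX coefC /=;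
    rewrite ?(mulr0, mulr1, add0r, addr0) //.
  exact: (leq_sizeP _ _ szr).
move: (r`_0) (r`_1) er => a b er.
have [|q1 e1] := @dvd_exp_congr _ G g r n _ Gg.
  by exists q0; rewrite [X in X - _]eg addrK.
(* The substitution u -> -u fixes [G], hence preserves multiples of [G]. The product r(u) r(-u) =
   a^2 - b^2 u^2 is congruent to the norm modulo [G]. *)
have e2 : (r * (r \Po (- 'X))) ^+ n = (q1 * (q1 \Po (- 'X)) * G) * G.
  rewrite exprMn -(rmorphXn (comp_poly (- 'X))) e1 /= comp_polyM comp_polyB.
  rewrite comp_polyC comp_Xn_poly sqrrN -/G; ring.
have [|q3 e3] :=
    @dvd_exp_congr _ G _ (a ^+ 2 - b ^+ 2 * S)%:P n _ (ex_intro _ _ e2).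
  exists (- (b ^+ 2)%:P).
  rewrite er comp_polyD comp_polyZ comp_polyX comp_polyC -!mul_polyC /G.
  by rewrite !(rmorphB, rmorphM, rmorphXn) /=; ring.
(* A nonzero multiple of the monic [G] has degree at least 2 in u, whereas a power of the norm is
   constant. *)
have /eqP q30 : q3 == 0.
  apply/negPn/negP => q3n; have := size_polyC_leq1 ((a ^+ 2 - b ^+ 2 * S) ^+ n).
  rewrite rmorphXn /= e3 size_Mmonic // szG addn3 /=.
  by rewrite ltnS ltnNge.
move: e3; rewrite q30 mul0r -rmorphXn => /eqP.
rewrite polyC_eq0 expf_eq0 subr_eq0 => /andP[_ /eqP ab].
have b0 := nsq _ _ ab; move: ab; rewrite b0 expr0n mul0r => /eqP.
rewrite expf_eq0 /= => /eqP a0.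
by exists q0; rewrite eg er a0 b0 scale0r !addr0.
Qed.

(** Parity of the multiplicity at c: it is even for a^2, but odd for b^2 S as soon as b is
    nonzero. *)
Lemma odd_mup_nonsquare (k : fieldType) (S : {poly k}) (c : k) :
  odd (mup c S) -> forall a b, a ^+ 2 = b ^+ 2 * S -> b = 0.
Proof.
move=> oddS a b ab; apply/eqP/negPn/negP => b0.
have S0 : S != 0.
  (* By construction [mup] is bounded by the size, so it is 0 on the zero polynomial and an odd
     value forces S to be nonzero. *)
  have mup_le : (mup c S <= size S)%N by apply: leq_ord.
  apply/eqP => S0; move: mup_le oddS.
  by rewrite S0 size_poly0 leqn0 => /eqP ->.
have a0 : a != 0.
  by have := mulf_neq0 (expf_neq0 2 b0) S0; rewrite -ab expf_eq0.
have := congr1 (odd \o mup c) ab.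
by rewrite /= !mupM ?mulf_neq0 // !oddD !addbb oddS.
Qed.

(** * The inclusion of k[x] in k[x, y]: derivatives, values at the origin, coefficients *)

HB.instance Definition _ (k : fieldType) :=
  GRing.RMorphism.copy (@inx k)
    (horner_eval (@varx k) \o map_poly (@mpolyC 2 k)).

Lemma inxC (k : fieldType) (c : k) : inx c%:P = c%:MP.
Proof. by rewrite /inx map_polyC hornerC. Qed.

Lemma inxX (k : fieldType) : inx 'X = varx :> {mpoly k[2]}.
Proof. by rewrite /inx map_polyX hornerX. Qed.

Lemma inxE (k : fieldType) (P : {poly k}) :
  inx P = \sum_(i < size P) P`_i *: varx ^+ i.
Proof.
rewrite -{1}[P]coefK poly_def rmorph_sum; apply: eq_bigr => i _ /=.
by rewrite -mul_polyC rmorphM rmorphXn /= inxC inxX mul_mpolyC.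
Qed.

Lemma mderivXU (n : nat) (R : nzRingType) (i j : 'I_n) :
  mderiv i ('X_j : {mpoly R[n]}) = (i == j)%:R.
Proof.
rewrite mderivX mnmE eq_sym; have [->|_] := eqVneq; last by rewrite scale0r.
by rewrite -{1}[U_(j)%MM]add0m addmK mpolyX0 scale1r.
Qed.

Lemma dpx_inx (k : fieldType) (P : {poly k}) : dpx (inx P) = inx P^`().
Proof.
rewrite /dpx; elim/poly_ind: P => [|P c IH].
  by rewrite deriv0 rmorph0 mderiv0.
rewrite !rmorphD !rmorphM /= inxX inxC mderivD mderivM mderivC IH.
rewrite derivD derivM derivX derivC !rmorphD !rmorphM /= inxX rmorph0 rmorph1.
by rewrite /varx mderivXU eqxx.
Qed.

Lemma dpy_inx (k : fieldType) (P : {poly k}) : dpy (inx P) = 0.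
Proof.
rewrite /dpy; elim/poly_ind: P => [|P c IH]; first by rewrite rmorph0 mderiv0.
rewrite !rmorphD !rmorphM /= inxX inxC mderivD mderivM mderivC IH.
by rewrite /varx mderivXU mul0r mulr0 !addr0.
Qed.

Lemma dpx_sqr_sub (k : fieldType) (Q S : {poly k}) :
  dpx ((vary + inx Q) ^+ 2 - inx S) =
  (vary + inx Q) * inx Q^`() *+ 2 - inx S^`().
Proof.
rewrite -!dpx_inx /dpx mderivB expr2 mderivM mderivD.
rewrite /vary mderivXU /= mulr0n; ring.
Qed.

Lemma dpy_sqr_sub (k : fieldType) (Q S : {poly k}) :
  dpy ((vary + inx Q) ^+ 2 - inx S) = (vary + inx Q) *+ 2.
Proof.
have := dpy_inx k Q; have := dpy_inx k S.
rewrite /dpy mderivB expr2 mderivM mderivD => -> ->.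
rewrite /vary mderivXU eqxx /= mulr1n; ring.
Qed.

HB.instance Definition _ (k : fieldType) :=
  GRing.RMorphism.copy (@ev0 k) (@meval 2 k (fun=> 0)).

Lemma ev0_inx (k : fieldType) (P : {poly k}) : ev0 (inx P) = P.[0].
Proof.
rewrite /ev0; elim/poly_ind: P => [|P c IH].
  by rewrite rmorph0 horner0 rmorph0.
rewrite rmorphD rmorphM /= inxX inxC rmorphD rmorphM /= mevalXU mevalC.
by rewrite hornerMXaddC !mulr0.
Qed.

Lemma ev0_vary (k : fieldType) : ev0 (@vary k) = 0.
Proof. by rewrite /ev0 mevalXU. Qed.

Lemma mcoeff_inx (k : fieldType) (P : {poly k}) (j : nat) :
  (inx P)@_(U_(0) *+ j) = P`_j.
Proof.
have XE i : (varx ^+ i : {mpoly k[2]})@_(U_(0) *+ j) = (i == j)%:R.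
  rewrite mcoeffXn; congr (_%:R); congr nat_of_bool.
  apply/eqP/eqP => [/(congr1 (fun mn : 'X_{1..2} => mn 0))|->//].
  by rewrite !mulmnE !mnmE eqxx !mul1n.
rewrite inxE raddf_sum /=; under eq_bigr do rewrite mcoeffZ XE.
have [jP|Pj] := ltnP j (size P).
  rewrite (bigD1 (Ordinal jP)) //= eqxx mulr1 big1 ?addr0 // => i ij.
  by rewrite -val_eqE /= in ij; rewrite (negPf ij) mulr0.
rewrite nth_default // big1 // => i _.
by rewrite ltn_eqF ?mulr0 // (leq_trans (ltn_ord i)).
Qed.

Lemma msize_inx_le (k : fieldType) (P : {poly k}) : (msize (inx P) <= size P)%N.
Proof.
rewrite inxE; apply: (leq_trans (msize_sum _ _ _)); apply/bigmax_leqP => i _.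
by rewrite (leq_trans (msizeZ_le _ _)) // mpolyXn msizeX mdegMn mdeg1 mul1n.
Qed.

(** * Reducedness and degree of the curve (y + Q)^2 = S *)

(* The coordinate change (x, y) = (x, u - Q(x)) identifies k[x, y] with
   k[x][u]. *)
Lemma reduced_sqr_sub (k : fieldType) (Q S : {poly k}) :
  (forall a b : {poly k}, a ^+ 2 = b ^+ 2 * S -> b = 0) ->
  reduced ((vary + inx Q) ^+ 2 - inx S).
Proof.
move=> nsq g n [q gn].
pose h : {rmorphism {mpoly k[2]} -> {poly {poly k}}} :=
  mmap (@polyC {poly k} \o @polyC k)
  (fun i : 'I_2 => if i == 0 then 'X%:P else 'X - Q%:P).
pose psi : {rmorphism {poly {poly k}} -> {mpoly k[2]}} :=
  horner_eval (vary + inx Q) \o map_poly (@inx k).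
have psiC (P : {poly k}) : psi P%:P = inx P.
  by rewrite /psi /= /horner_eval map_polyC hornerC.
have psiX : psi 'X = vary + inx Q.
  by rewrite /psi /= /horner_eval map_polyX hornerX.
have hx : h varx = 'X%:P by rewrite /h /= mmapX mmap1U.
have hy : h vary = 'X - Q%:P by rewrite /h /= mmapX mmap1U.
have hC c : h c%:MP = c%:P%:P by rewrite /h /= mmapC.
have hinx P : h (inx P) = P%:P.
  elim/poly_ind: P => [|P c IH]; first by rewrite !rmorph0.
  by rewrite !rmorphD !rmorphM /= inxX inxC IH hx hC.
(* This left inverse of [h] carries a divisibility found in k[x][u] back to k[x, y]. *)
have psih f : psi (h f) = f.
  rewrite [RHS]mpolyE [in LHS](mpolyE f) (rmorph_sum h) (rmorph_sum psi).
  apply: eq_bigr => mn _.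
  rewrite -!mul_mpolyC (rmorphM h) hC (rmorphM psi) psiC inxC; congr (_ * _).
  rewrite mpolyXE_id (rmorph_prod h) (rmorph_prod psi).
  apply: eq_bigr => i _; rewrite (rmorphXn h) (rmorphXn psi).
  congr (_ ^+ _); case: i => [[|[|//]]] lti.
    rewrite (_ : Ordinal lti = 0); last exact: val_inj.
    by rewrite -/varx hx psiC inxX.
  rewrite (_ : Ordinal lti = 1); last exact: val_inj.
  by rewrite -/vary hy (rmorphB psi) psiX psiC addrK.
have [|s es] := @dvd_exp_sqr_sub _ S (h g) n nsq.
  exists (h q); rewrite -rmorphXn gn rmorphM; congr (_ * _).
  by rewrite rmorphB rmorphXn rmorphD hy !hinx subrK.
exists (psi s); rewrite -{1}[g]psih es rmorphM; congr (_ * _).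
by rewrite rmorphB rmorphXn psiX psiC.
Qed.

(** Upper bound: f = y (y + 2Q) + (Q^2 - S), where both summands have degree at most d + 1. Lower
    bound: the monomial x^d y occurs in f with twice the leading coefficient of Q. *)
Lemma has_degree_sqr_sub (k : fieldType) (Q S : {poly k}) (d : nat) :
  2%:R != 0 :> k -> (0 < d)%N -> size Q = d.+1 ->
  (size (Q ^+ 2 - S)%R <= d.+2)%N ->
  has_degree ((vary + inx Q) ^+ 2 - inx S) d.+1.
Proof.
move=> two d0 szQ szQS; rewrite /has_degree; apply/eqP.
rewrite eqn_leq; apply/andP; split.
  have -> : (vary + inx Q) ^+ 2 - inx S
      = vary * (vary + inx Q *+ 2) + inx (Q ^+ 2 - S).
    by rewrite rmorphB rmorphXn /=; ring.
  apply: (leq_trans (msizeD_le _ _)); rewrite geq_max.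
  apply/andP; split; last first.
    exact: leq_trans (msize_inx_le _ _) szQS.
  have [->|nz] := eqVneq (vary + inx Q *+ 2) 0; first by rewrite mulr0 msize0.
  have vy : @vary k != 0 by rewrite -msize_poly_eq0 msizeX.
  rewrite msizeM // {1}/vary msizeX mdeg1 /= add1n.
  rewrite ltnS; apply: (leq_trans (msizeD_le _ _)); rewrite geq_max.
  rewrite /vary msizeX mdeg1 -scaler_nat ltnS d0 (leq_trans (msizeZ_le _ _)) //.
  by rewrite -szQ msize_inx_le.
(* The coefficient of x^d y in f is read off as that of x^d in the y-derivative 2(y + Q). *)
set f := _ - _; have := mcoeff_deriv 1 (U_(0) *+ d) f.
rewrite -[mderiv _ _]/(dpy f) dpy_sqr_sub mcoeffMn mcoeffD mcoeff_inx.
have yd : (U_(1%R) == U_(0%R) *+ d :> 'X_{1..2})%MM = false.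
  apply/eqP => /(congr1 (fun mn : 'X_{1..2} => mn 1)).
  by rewrite mulmnE !mnmE.
rewrite mulmnE mnmE /= mul0n mulr1n /vary mcoeffX yd add0r => e.
have fd : f@_(U_(0) *+ d + U_(1)) != 0.
  rewrite -e -mulr_natl mulf_neq0 //.
  have := lead_coef_eq0 Q.
  by rewrite lead_coefE szQ /= -size_poly_eq0 szQ => ->.
rewrite -mcoeff_msupp in fd; have := msize_mdeg_lt fd.
by rewrite mdegD mdegMn !mdeg1 mul1n addn1.
Qed.

(** * Expansion of the square root of S at infinity *)

(** The fixed terms of [Q] begin the expansion of x^(m+1) sqrt(1 + 2/x). One further coefficient of
    [R] is adjusted to remove the top term of the error Q^2 - S. *)
Lemma sqrt_at_infinity_step (k : fieldType) (m n : nat) (R : {poly k}) :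
  let Q R := 'X ^+ m.+1 + 'X ^+ m - 2%:R^-1 *: 'X ^+ m.-1 + R in
  let S := 'X ^+ (m.*2.+1) * (2%:R + 'X) in
  2%:R != 0 :> k -> (n < m - 3)%N ->
  (size R <= m.-1)%N -> R.[0] = 0 ->
  (size (Q R ^+ 2 - S)%R <= m.*2 - n)%N ->
  exists R' : {poly k}, [/\ (size R' <= m.-1)%N, R'.[0] = 0 &
    (size (Q R' ^+ 2 - S)%R <= m.*2 - n.+1)%N].
Proof.
move=> Q S two nm szR R0 szT; set T := _ - _ in szT.
(* Adding c x^a changes the error by 2c x^a Q + c^2 x^(2a). Its top degree a + m + 1 is 2m - n - 1,
   the index of [e], so c = -e/2 cancels [e]. As n < m - 3, a is at least 2, which keeps R(0) =
   0. *)
pose a := (m - n - 2)%N; pose e := T`_(m.*2 - n.+1).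
exists (R - (e / 2%:R) *: 'X ^+ a); split.
- apply: leq_trans (size_polyD _ _) _; rewrite geq_max szR size_polyN.
  by rewrite (leq_trans (size_scale_leq _ _)) // size_polyXn /a; lia.
- rewrite !(hornerE, hornerXn) R0 expr0n gtn_eqF ?mulr0 ?subr0 // /a; lia.
have -> : Q (R - (e / 2%:R) *: 'X ^+ a) ^+ 2 - S
    = T - e *: (Q R * 'X ^+ a) + (e / 2%:R) ^+ 2 *: 'X ^+ (a + a).
  have half : e = e / 2%:R * 2%:R by rewrite divfK.
  rewrite /T {2}half /Q exprD -!mul_polyC rmorphXn.
  by rewrite [((_ * 2%:R)%:P)]rmorphM /= (rmorph_nat (@polyC k)); ring.
have szQ : (size (Q R) <= m.+2)%N.
  apply/leq_sizeP => i im; rewrite !(coefD, coefN, coefZ, coefXn).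
  rewrite (leq_sizeP _ _ szR); last lia.
  rewrite !gtn_eqF /=; try lia.
  by rewrite mulr0 subr0 !addr0.
have Q1 : (Q R)`_m.+1 = 1.
  rewrite !(coefD, coefN, coefZ, coefXn) eqxx (leq_sizeP _ _ szR); last lia.
  rewrite !gtn_eqF /=; try lia.
  by rewrite mulr0 subr0 !addr0.
move: (Q R) szQ Q1 T szT @e => A szA A1 T szT e.
apply/leq_sizeP => i ilow; rewrite !(coefD, coefN, coefZ, coefXn, coefMXn).
rewrite (_ : (i == a + a)%N = false) ?mulr0 ?addr0; last by rewrite /a; lia.
rewrite ifF; last by rewrite /a; lia.
have [->|ine] := eqVneq i (m.*2 - n.+1)%N.
  rewrite (_ : (_ - a)%N = m.+1); last by rewrite /a; lia.
  by rewrite A1 mulr1 subrr.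
rewrite (leq_sizeP _ _ szT); last lia.
by rewrite (leq_sizeP _ _ szA) ?mulr0 ?subrr // /a; lia.
Qed.

(** P collects the terms of the expansion below x^m; its leading coefficient -1/2 fixes its degree
    as m - 1. *)
Lemma sqrt_at_infinity (k : fieldType) (m : nat) :
  2%:R != 0 :> k -> (2 <= m)%N ->
  exists P : {poly k}, [/\ P.[0] = 0, size P = m &
    (size ((P + 'X ^+ m + 'X ^+ m.+1) ^+ 2 - 'X ^+ (m.*2.+1) * (2%:R + 'X))%R
     <= m.+3)%N].
Proof.
move=> two m2.
pose Q R : {poly k} := 'X ^+ m.+1 + 'X ^+ m - 2%:R^-1 *: 'X ^+ m.-1 + R.
pose S : {poly k} := 'X ^+ (m.*2.+1) * (2%:R + 'X).
have half : 2%:R^-1 *: (2%:R : {poly k}) = 1.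
  by rewrite -polyC_natr -mul_polyC -polyCM mulVf.
have : forall n, (n <= m - 3)%N ->
    exists R : {poly k}, [/\ (size R <= m.-1)%N, R.[0] = 0 &
    (size (Q R ^+ 2 - S)%R <= m.*2 - n)%N].
  elim=> [_|n IH nm]; last first.
    have [|R [szR R0 szT]] := IH; first exact: ltnW.
    exact: sqrt_at_infinity_step szT.
  exists 0; split; rewrite ?size_poly0 ?horner0 //.
  have -> : Q 0 ^+ 2 - S =
      (2%:R^-1) ^+ 2 *: 'X ^+ (m.-1 + m.-1) - 'X ^+ (m + m.-1).
    have [l ml] : exists l, m = l.+1 by exists m.-1; lia.
    pose c : {poly k} := (2%:R^-1)%:P.
    have c2 : c * 2%:R = 1 by rewrite mul_polyC.
    rewrite /Q /S ml -!mul_polyC rmorphXn /= -/c.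
    rewrite -addnn addSn; set X := 'X; set x := X ^+ l.
    (* For [ring], [c] is an atom unrelated to 2, so the products c * 2 are isolated first and then
       replaced by 1. *)
    transitivity ((1 - c * 2%:R) * X ^+ 2 * x ^+ 2 - (c * 2%:R) * X * x ^+ 2
                  + c ^+ 2 * (x * x)); last first.
      by rewrite c2 !(exprS, exprD) -/x; ring.
    by rewrite !(exprS, exprD) -/x; ring.
  apply: leq_trans (size_polyD _ _) _; rewrite geq_max size_polyN size_polyXn.
  by rewrite (leq_trans (size_scale_leq _ _)) ?size_polyXn; lia.
(* At n = m - 3 the bound 2m - n equals m + 3. For m = 2 truncated subtraction gives n = 0 and the
   bound 4, still below m + 3. *)
move=> /(_ _ (leqnn _)) [R [szR R0 szT]].
exists (- (2%:R^-1 *: 'X ^+ m.-1) + R); split.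
- rewrite !(hornerE, hornerXn) R0 expr0n gtn_eqF ?mulr0 ?oppr0 ?addr0 //; lia.
- rewrite size_polyDl size_polyN size_scale ?invr_neq0 // size_polyXn; lia.
rewrite (_ : _ + _ = Q R) ?(leq_trans szT) //; first lia.
by rewrite /Q; ring.
Qed.

(** * The curve and the invariant form in characteristic p *)

Theorem proposition3p6 (k : closedFieldType) (p : nat)
  (char_k : p \in [pchar k]) (p_ge5 : (5 <= p)%N) :
  exists (w : form1 k) (f : {mpoly k[2]}),
    [/\ form1_at0 w <> (0, 0),
        leaves_invariant w f,
        reduced f,
        has_degree f (uphalf p + 1)%N &
        singular_at0 f] /\
    exists P : {poly k},
      [/\ P.[0] = 0,
          size P = (p./2 - 1).+1%N &
          f = (vary + inx P + varx ^+ p./2 + varx ^+ uphalf p) ^+ 2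
              - varx ^+ p * (2%:R + varx)].
Proof.
have p_pr := pcharf_prime char_k.
have [m pE] : exists m, p = m.*2.+1.
  exists p./2; have [p2|oddp] := even_prime p_pr; first by rewrite p2 in p_ge5.
  by rewrite -[LHS]odd_double_half oddp.
have m2 : (2 <= m)%N by lia.
have [-> ->] : p./2 = m /\ uphalf p = m.+1 by lia.
have two : 2%:R != 0 :> k.
  rewrite -(dvdn_pcharf char_k) gtnNdvd //; lia.
have [P [P0 szP szQS]] := @sqrt_at_infinity k m two m2.
pose Q : {poly k} := P + 'X ^+ m + 'X ^+ m.+1.
pose S : {poly k} := 'X ^+ p * (2%:R + 'X).
have Q0 : Q.[0] = 0.
  by rewrite /Q !hornerD !hornerXn P0 !expr0n gtn_eqF ?addr0 //; lia.
have inxQ : vary + inx P + varx ^+ m + varx ^+ m.+1 = vary + inx Q.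
  by rewrite /Q !rmorphD !rmorphXn /= inxX !addrA.
have inxS : varx ^+ p * (2%:R + varx) = inx S.
  by rewrite /S rmorphM rmorphXn rmorphD rmorph_nat /= inxX.
(* The other term of the product rule carries the factor p, which is 0 in k. *)
have derS : S^`() = 'X ^+ p.
  rewrite /S derivM derivXn derivD derivX -polyC_natr derivC add0r mulr1.
  by rewrite -mulr_natl -polyC_natr (pcharf0 char_k) !mul0r add0r.
pose u : {mpoly k[2]} := vary + inx Q.
have ev0u : ev0 u = 0 by rewrite rmorphD /= ev0_vary ev0_inx Q0 addr0.
pose t : {mpoly k[2]} := 2%:R + varx.
(* This is u dx - 2t du, expanded with du = dy + Q' dx. *)
exists (Form1 (u - t * inx Q^`() *+ 2) (- (t *+ 2))), (u ^+ 2 - inx S).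
split; last first.
  by exists P; split=> //; [rewrite szP; lia | rewrite inxQ inxS].
split.
- case=> _ /eqP; rewrite rmorphN rmorphMn rmorphD rmorph_nat /= -inxX.
  rewrite ev0_inx hornerX addr0.
  by rewrite oppr_eq0 -mulr_natl mulf_eq0 (negPf two).
(* The terms 4tuQ' cancel, leaving 2u^2 - 2t x^p, and t x^p is S. *)
- exists 2%:R; rewrite /wedge /= dpx_sqr_sub dpy_sqr_sub derS -/u -inxS -/t.
  by rewrite rmorphXn /= inxX; ring.
(* S has multiplicity exactly p at 0, because 2 + x does not vanish there, and p is odd. *)
- apply: reduced_sqr_sub; apply: (@odd_mup_nonsquare _ _ 0).
  rewrite /S mupMl; last by rewrite rootE -polyC_natr !hornerE.
  by rewrite -['X]subr0 -polyC0 mup_XsubCX eqxx pE /= odd_double.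
- rewrite addn1; apply: has_degree_sqr_sub => //.
    rewrite /Q addrC size_polyDl size_polyXn //.
    apply: leq_ltn_trans (size_polyD _ _) _; rewrite szP size_polyXn; lia.
  by rewrite /S pE.
(* At the origin u, S and S' = x^p all vanish, hence so do f and both its partial derivatives. *)
split.
- rewrite rmorphB rmorphXn /= ev0u ev0_inx expr0n sub0r /S hornerM.
  by rewrite hornerXn expr0n pE mul0r oppr0.
- rewrite dpx_sqr_sub rmorphB rmorphMn rmorphM /= ev0u mul0r mul0rn.
  by rewrite ev0_inx derS hornerXn expr0n pE subr0.
- by rewrite dpy_sqr_sub rmorphMn /= ev0u mul0rn.
Qed.
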